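(* Let $N\ge2$ and let $A=(a_{ij})_{i,j=0}^{N-1}$, $B=(b_{ij})_{i,j=0}^{N-1}$ be two $N\times N$ unitary matrices with constant first row $1/\sqrt N$. Then the change of basis matrix from $\{W_n^A\}_{n\ge0}$ to $\{W_n^B\}_{n\ge0}$ is given by the entries $$M_{nm}=\langle W_n^B,W_m^A\rangle=(BA^* )_{n_1m_1}(BA^* )_{n_2m_2}\cdots(BA^* )_{n_pm_p}=\big((BA^* )^{\otimes p}\big)_{nm},\qquad m,n\in\{0,1,2,\dots\},$$ where $n=n_1+Nn_2+\cdots$ and $m=m_1+Nm_2+\cdots$ are the base-$N$ representations, and $p\geq 1$ is chosen such that $n_k=m_k=0$ for $k>p$.
   Context: The inner product on $L^2[0,1]$ is $\langle f,g\rangle=\int_0^1 f\overline g\,dx$. For a unitary $N\times N$ matrix $A$ with first row constant $1/\sqrt N$, put $m_i(x)=\sqrt N\sum_{j=0}^{N-1}a_{ij}\chi_{[j/N,(j+1)/N)}(x)$ and $S_if(x)=m_i(x)f(Nx\bmod 1)$ on $L^2[0,1]$, $i=0,\dots,N-1$ (so $S_01=1$). The generalized Walsh functions are $W_n^A=S_{n_1}\cdots S_{n_p}1$ for $n=n_1+Nn_2+\cdots$ with $n_k=0$ for $k>p$ (independent of the choice of $p$). It is known that $\{W_n^A\}_{n\ge0}$ is an orthonormal basis of $L^2[0,1]$. $W_n^B$ is defined likewise from $B$. Matrix rows and columns are indexed from $0$. Tensor product convention: for $C$ of size $N\times N$ and $D$ of size $M\times M$, $(C\otimes D)_{i_1+Ni_2,\,j_1+Nj_2}=C_{i_1j_1}D_{i_2j_2}$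 for $0\le i_1,j_1\le N-1$, $0\le i_2,j_2\le M-1$. $C^{\otimes1}=C$, $C^{\otimes n}=C\otimes C^{\otimes(n-1)}$. *)

(* Defs.v *)
From HB Require Import structures.
From mathcomp Require Import all_boot all_order all_algebra.
From mathcomp Require Import complex.
From mathcomp Require Import all_classical all_reals all_analysis.
Set Implicit Arguments.
Unset Strict Implicit.
Unset Printing Implicit Defensive.
Import Order.TTheory GRing.Theory Num.Theory.
Import numFieldNormedType.Exports.
Local Open Scope classical_set_scope.
Local Open Scope ring_scope.

(* Elements of L^2[0,1] are represented by functions R -> R[i], of which only
   the restriction to [0,1], up to a null set, is relevant. *)

Definition cintegral01 (R : realType) (f : R -> R[i]) : R[i] :=
  Complex (\int[lebesgue_measure]_(x in `[0, 1]) complex.Re (f x))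
          (\int[lebesgue_measure]_(x in `[0, 1]) complex.Im (f x)).

Definition inner (R : realType) (f g : R -> R[i]) : R[i] :=
  cintegral01 (fun x => f x * (g x)^*).

Definition sqr_dist (R : realType) (f g : R -> R[i]) : \bar R :=
  (\int[lebesgue_measure]_(x in `[0%R, 1%R])
      (ComplexField.Normc.normc (f x - g x) ^+ 2)%:E)%E.

(* f_n = sum_m M_{nm} e_m for every n, the series converging in L^2[0,1]. *)
Definition change_of_basis (R : realType) (e f : nat -> R -> R[i])
    (M : nat -> nat -> R[i]) : Prop :=
  forall n, (fun K : nat =>
    sqr_dist (f n) (fun x => \sum_(m < K) M n m * e m x)) @ \oo --> 0%E.

Definition const_first_row (R : realType) (N : nat) (A : 'M[R[i]]_N) : Prop :=
  forall i j : 'I_N, i = 0%N :> nat -> A i j = (sqrtC N%:R)^-1.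

Definition walsh_filter (R : realType) (N : nat) (A : 'M[R[i]]_N) (i : 'I_N)
    (x : R) : R[i] :=
  sqrtC N%:R * \sum_(j < N) A i j * \1_(`[j%:R / N%:R, j.+1%:R / N%:R[) x.

Definition walsh_op (R : realType) (N : nat) (A : 'M[R[i]]_N) (i : 'I_N)
    (f : R -> R[i]) (x : R) : R[i] :=
  walsh_filter A i x * f (N%:R * x - (Num.floor (N%:R * x))%:~R).

(* Digits are numbered from 0: n = digit n 0 + N * digit n 1 + ... *)
Definition digit (N : nat) (N_gt0 : (0 < N)%N) (n k : nat) : 'I_N :=
  Ordinal (ltn_pmod (n %/ N ^ k)%N N_gt0).

Definition walsh_upto (R : realType) (N : nat) (N_gt0 : (0 < N)%N)
    (A : 'M[R[i]]_N) (p n : nat) : R -> R[i] :=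
  foldr (walsh_op A) (fun=> 1) [seq digit N_gt0 n k | k <- iota 0 p].

(* Since n < N ^ n for N >= 2, the digits of n of index at least n vanish. *)
Definition walsh (R : realType) (N : nat) (N_gt0 : (0 < N)%N)
    (A : 'M[R[i]]_N) (n : nat) : R -> R[i] := walsh_upto N_gt0 A n n.

Lemma digits_ltn (N : nat) (N_gt1 : (1 < N)%N) (p n : nat) :
  (forall k, (p <= k)%N -> digit (ltnW N_gt1) n k = 0%N :> nat) ->
  (n < N ^ p)%N.
Proof.
move=> n0; rewrite ltnNge; apply/negP => le_pn.
have N_gt0 := ltnW N_gt1.
have n_gt0 : (0 < n)%N by apply: leq_trans le_pn; rewrite expn_gt0 N_gt0.
have := n0 (trunc_log N n) (trunc_log_max N_gt1 le_pn) => /=.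
have /andP[le_n lt_n] := trunc_log_bounds N_gt1 n_gt0.
rewrite modn_small; last by rewrite ltn_divLR ?expn_gt0 ?N_gt0 // -expnS.
by move=> d0; move: le_n; rewrite -(divn_gt0 n) ?expn_gt0 ?N_gt0 // d0.
Qed.

Lemma digit_small (N : nat) (N_gt0 : (0 < N)%N) (n k : nat) :
  (n < N ^ k)%N -> digit N_gt0 n k = 0%N :> nat.
Proof. by move=> lt_n /=; rewrite divn_small // mod0n. Qed.

Section WalshIndependence.
Variables (R : realType) (N : nat) (N_gt1 : (1 < N)%N) (A : 'M[R[i]]_N).
Hypothesis A_row0 : const_first_row A.

Lemma walsh_op1 (i : 'I_N) (x : R) : i = 0%N :> nat -> 0 <= x < 1 ->
  walsh_op A i (fun=> 1) x = 1.
Proof.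
move=> i0 /andP[x_ge0 x_lt1]; rewrite /walsh_op /walsh_filter mulr1.
have N_gt0 : 0 < N%:R :> R by rewrite ltr0n ltnW.
have Nx_ge0 : 0 <= N%:R * x by rewrite mulr_ge0 // ltW.
have jP := truncn_itv Nx_ge0.
have ltjN : (Num.truncn (N%:R * x) < N)%N.
  by rewrite -(ltr_nat R); case/andP: jP => /le_lt_trans-> //; rewrite gtr_pMr.
rewrite (bigD1 (Ordinal ltjN)) //= big1 ?addr0 => [|j neq_j].
  rewrite A_row0 // indicE mem_set /=.
    by rewrite mulr1 divff // sqrtC_eq0 pnatr_eq0 -lt0n ltnW.
  by rewrite in_itv /= ler_pdivrMr // ltr_pdivlMr // [x * _]mulrC.
rewrite indicE memNset ?mulr0 //= in_itv /= ler_pdivrMr // ltr_pdivlMr //.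
rewrite [x * _]mulrC => jxP; case/negP: neq_j; apply/eqP/val_inj => /=.
by apply/esym/eqP; rewrite truncn_eq.
Qed.

Lemma walsh_op_eq (i : 'I_N) (f g : R -> R[i]) :
  (forall x, 0 <= x < 1 -> f x = g x) ->
  forall x, 0 <= x < 1 -> walsh_op A i f x = walsh_op A i g x.
Proof.
move=> fg x _; rewrite /walsh_op fg // subr_ge0 floor_le.
by rewrite ltrBlDl -[X in _ + X]/(1%:~R) -intrD floorD1_gt.
Qed.

(* The choice of the number of digits does not matter, as a function on
   [0,1). *)
Lemma walsh_uptoE (p n : nat) :
  (forall k, (p <= k)%N -> digit (ltnW N_gt1) n k = 0%N :> nat) ->
  forall x, 0 <= x < 1 ->
  walsh_upto (ltnW N_gt1) A p n x = walsh (ltnW N_gt1) A n x.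
Proof.
have step q : (forall k, (q <= k)%N -> digit (ltnW N_gt1) n k = 0%N :> nat) ->
    forall r x, 0 <= x < 1 -> walsh_upto (ltnW N_gt1) A (q + r) n x =
                              walsh_upto (ltnW N_gt1) A q n x.
  move=> q0 r; rewrite /walsh_upto iotaD map_cat foldr_cat add0n.
  have tail x : 0 <= x < 1 -> foldr (walsh_op A) (fun=> 1)
      [seq digit (ltnW N_gt1) n k | k <- iota q r] x = 1.
    elim: r q q0 x => //= r IHr q q0 x x01.
    rewrite (@walsh_op_eq _ _ (fun=> 1)) // => [|y y01].
      by apply: walsh_op1 => //; apply: q0.
    by apply: IHr => // k /ltnW/q0.
  by elim: (iota 0 q) => //= k s IHs x; apply: walsh_op_eq.
move=> p0 x x01; have n0 k : (n <= k)%N -> digit (ltnW N_gt1) n k = 0%N :> nat.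
  move=> le_nk; apply: digit_small.
  by apply: leq_trans (ltn_expl n N_gt1) _; rewrite leq_pexp2l ?(ltnW N_gt1).
by rewrite /walsh -(step p p0 n) // addnC step.
Qed.

End WalshIndependence.

Lemma tensor_lo_subproof (N M : nat) (i : 'I_(N * M)) : (i %% N < N)%N.
Proof. by rewrite ltn_mod; case: N i => [[]|]. Qed.

Lemma tensor_hi_subproof (N M : nat) (i : 'I_(N * M)) : (i %/ N < M)%N.
Proof.
by rewrite ltn_divLR ?[(M * N)%N]mulnC ?ltn_ord //; case: N i => [[]|].
Qed.

Definition tensor_lo (N M : nat) (i : 'I_(N * M)) : 'I_N :=
  Ordinal (tensor_lo_subproof i).
Definition tensor_hi (N M : nat) (i : 'I_(N * M)) : 'I_M :=
  Ordinal (tensor_hi_subproof i).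

(* Not mxtens.tensmx, in which the index of the left factor is the most
   significant one: here it is the least significant, i = i_1 + N i_2. *)
Definition tensor (K : pzRingType) (N M : nat) (C : 'M[K]_N) (D : 'M[K]_M) :
    'M[K]_(N * M) :=
  \matrix_(i, j) (C (tensor_lo i) (tensor_lo j) * D (tensor_hi i) (tensor_hi j)).

(* Powers with exponent p >= 1 start from C itself; N ^ 1 and N ^ q.+2 are
   convertible to N and N * N ^ q.+1. The exponent 0 is a dummy case. *)
Fixpoint tensor_exp (K : pzRingType) (N : nat) (C : 'M[K]_N) (p : nat) :
    'M[K]_(N ^ p) :=
  match p return 'M[K]_(N ^ p) with
  | 0 => 1%:M
  | p'.+1 =>
    match p' return 'M[K]_(N ^ p') -> 'M[K]_(N ^ p'.+1) with
    | 0 => fun=> C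
    | _.+1 => fun D => tensor C D
    end (tensor_exp C p')
  end.

(* Main.v *)
(** Put [C := B A^*].  For [n, m < N^p], the function [W_n^B conj(W_m^A)] is
    constant on each cell [l/N^p <= x < (l+1)/N^p] of [0,1), where it equals [N^p]
    times a product, over the digits of [l], of entries of [B] and conjugate
    entries of [A]; averaging over the cells turns each digit into one entry of
    [C].  As [B = C A], the filters of [B] are combinations of those of [A] with
    coefficients from [C], whence [W_n^B] is the sum of the [M_nm W_m^A] with
    [m < N^p].  The first row of [C] is that of the identity, so [M_nm = 0] for
    [m >= N^p] and the partial sums eventually equal [W_n^B] on [0,1). *)
Require Import Defs.
From HB Require Import structures.
From mathcomp Require Import all_boot all_order all_algebra.
From mathcomp Require Import complex.
From mathcomp Require Import all_classical all_reals all_analysis.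
From mathcomp Require Import measurable_realfun.
Set Implicit Arguments.
Unset Strict Implicit.
Unset Printing Implicit Defensive.
Import Order.TTheory GRing.Theory Num.Theory.
Import numFieldNormedType.Exports.
Local Open Scope classical_set_scope.
Local Open Scope sesquilinear_scope.
Local Open Scope ring_scope.

(** Used to split one base-[N] digit off a summation index: the leading digit when [a = N], the
    lowest one when [b = N]. *)
Lemma sum_ord_mul (V : nmodType) (a b : nat) (F : nat -> V) :
  \sum_(l < a * b) F l = \sum_(i < a) \sum_(j < b) F (i * b + j)%N.
Proof.
rewrite -(big_mkord xpredT F) big_nat_mul big_mkord; apply: eq_bigr => i _.
rewrite -{1}[(i * b)%N]add0n big_addn mulSn addnK big_mkord.
by apply: eq_bigr => j _; rewrite addnC.
Qed.

(** * Integrals of functions constant on the cells of a uniform grid *)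

Section StepIntegral.
Variables (R : realType) (M : nat).
Hypothesis M_gt0 : (0 < M)%N.

(** Induction on the number of cells. Integrability is carried along because additivity of the
    integral over a disjoint union requires it. *)
Lemma Rintegral_step (g : R -> R) (c : nat -> R) (k : nat) :
  (forall l x, (l < k)%N -> l%:R / M%:R <= x < l.+1%:R / M%:R -> g x = c l) ->
  lebesgue_measure.-integrable `[0, k%:R / M%:R[ (EFin \o g) /\
  \int[lebesgue_measure]_(x in `[0, k%:R / M%:R[) g x =
    M%:R^-1 * \sum_(l < k) c l.
Proof.
elim: k => [|k IHk] gc.
  rewrite mul0r set_itvco0 Rintegral_set0 big_ord0 mulr0; split => //.
  exact: integrable_set0.
have [|gi gE] := IHk; first by move=> l x /ltnW; apply: gc.
have M_ge0 : 0 <= M%:R^-1 :> R by rewrite invr_ge0.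
have le_k : k%:R / M%:R <= k.+1%:R / M%:R :> R by rewrite ler_wpM2r // ler_nat.
have -> : `[0, k.+1%:R / M%:R[%classic =
    `[0, k%:R / M%:R[%classic `|` `[k%:R / M%:R, k.+1%:R / M%:R[%classic
    :> set R.
  by rewrite -itv_bndbnd_setU // bnd_simp // divr_ge0.
have gk : {in `[k%:R / M%:R, k.+1%:R / M%:R[%classic, cst (c k) =1 g}.
  by move=> x; rewrite inE /= in_itv /= => xk; rewrite (gc k).
have gi' : lebesgue_measure.-integrable
    `[k%:R / M%:R, k.+1%:R / M%:R[ (EFin \o g).
  apply: (@eq_integrable _ _ _ lebesgue_measure _ _ (EFin \o cst (c k))) => //.
    by move=> x /gk /= ->.
  apply/integrableP; split; first exact/measurable_EFinP.
  rewrite (integral_cst _ _ (`|c k|%:E)) //= lebesgue_measure_itv /=.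
  by case: ifP => _; rewrite ?mule0 ?ltry // -EFinD -EFinM ltry.
have disj : disj_set (`[0, k%:R / M%:R[%classic : set R)
    `[k%:R / M%:R, k.+1%:R / M%:R[%classic.
  apply/disj_setPS => x [/=]; rewrite !in_itv /= => /andP[_ xk] /andP[].
  by rewrite leNgt xk.
have giU : lebesgue_measure.-integrable ((`[0, k%:R / M%:R[%classic : set R) `|`
    `[k%:R / M%:R, k.+1%:R / M%:R[%classic) (EFin \o g).
  have [/integrableP[mg ig] /integrableP[mg' ig']] := (gi, gi').
  have mU : measurable_fun ((`[0, k%:R / M%:R[%classic : set R) `|`
      `[k%:R / M%:R, k.+1%:R / M%:R[%classic) (EFin \o g).
    exact/measurable_funU.
  apply/integrableP; split=> //; rewrite ge0_integral_setU //.
    exact: lte_add_pinfty.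
  exact: measurableT_comp.
split=> //; rewrite Rintegral_setU //.
rewrite gE [X in _ + X](@eq_Rintegral _ _ _ _ _ (cst (c k))); last first.
  by move=> x /gk.
rewrite Rintegral_cst // [X in _ * fine X](_ : _ = M%:R^-1%:E).
  by rewrite big_ord_recr mulrDr [c k * _]mulrC.
apply: (etrans (lebesgue_measure_itv _)) => /=.
rewrite lte_fin ltr_pM2r ?invr_gt0 ?ltr0n // ltr_nat ltnSn -EFinD.
by rewrite -mulrBl -natrB // subSnn mul1r.
Qed.

(** The value of [g] at 1 is unconstrained, but a single point is null. *)
Lemma Rintegral01_step (g : R -> R) (c : nat -> R) :
  (forall l x, (l < M)%N -> l%:R / M%:R <= x < l.+1%:R / M%:R -> g x = c l) ->
  \int[lebesgue_measure]_(x in `[0, 1]) g x = M%:R^-1 * \sum_(l < M) c l.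
Proof.
move=> /Rintegral_step; rewrite divff ?pnatr_eq0 -?lt0n // => -[gi <-].
by rewrite -Rintegral_itv_bndo_bndc.
Qed.

Lemma cintegral01_step (h : R -> R[i]) (c : nat -> R[i]) :
  (forall l x, (l < M)%N -> l%:R / M%:R <= x < l.+1%:R / M%:R -> h x = c l) ->
  cintegral01 h = M%:R^-1 * \sum_(l < M) c l.
Proof.
move=> hc; rewrite /cintegral01.
rewrite (@Rintegral01_step _ (fun l => complex.Re (c l))) => [|l x ? /hc-> //].
rewrite (@Rintegral01_step _ (fun l => complex.Im (c l))) => [|l x ? /hc-> //].
have -> : \sum_(l < M) c l = Complex (\sum_(l < M) complex.Re (c l))
                                     (\sum_(l < M) complex.Im (c l)).
  by elim/big_rec3: _ => // l a b _ _ ->; case: (c l).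
(* The factor [1/M] is real, so it scales the real and imaginary parts separately. *)
rewrite -(rmorph_nat (real_complex R)) -fmorphV.
by rewrite /GRing.mul /= !mul0r subr0 addr0.
Qed.

End StepIntegral.

(** * Walsh functions on [N]-adic cells and their inner products *)

Section WalshDigits.
Variables (R : realType) (N : nat) (N_gt0 : (0 < N)%N).
Implicit Types (A B C : 'M[R[i]]_N) (f : R -> R[i]).

Let N_pos : 0 < N%:R :> R. Proof. by rewrite ltr0n. Qed.

Lemma walsh_filterE A (i j : 'I_N) (x : R) :
  j%:R / N%:R <= x < j.+1%:R / N%:R -> walsh_filter A i x = sqrtC N%:R * A i j.
Proof.
move=> xj; rewrite /walsh_filter (bigD1 j) //= big1 ?addr0 => [|k neq_k].
  by rewrite indicE mem_set ?mulr1 //= in_itv.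
rewrite indicE memNset ?mulr0 //= in_itv /= => xk; case/negP: neq_k.
move: xj xk; rewrite !ler_pdivrMr // !ltr_pdivlMr // => xj xk.
have x_ge0 : 0 <= x * N%:R by case/andP: xj => /(le_trans _)->.
apply/eqP/val_inj => /=; rewrite -truncn_eq // in xj.
rewrite -truncn_eq // in xk.
by rewrite -(eqP xj) (eqP xk).
Qed.

Lemma walsh_opE A (i j : 'I_N) f (x : R) :
  j%:R / N%:R <= x < j.+1%:R / N%:R ->
  walsh_op A i f x = sqrtC N%:R * A i j * f (N%:R * x - j%:R).
Proof.
move=> xj; rewrite /walsh_op (walsh_filterE _ _ xj); congr (_ * f (_ - _)).
rewrite (@floor_def _ _ j%:Z) // intrD mulr1z -pmulrn natr1.
by move: xj; rewrite ler_pdivrMr // ltr_pdivlMr // [x * _]mulrC.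
Qed.

(** Induction on the list [s] of digit pairs. On cell [l] both outer filters are constant,
    determined by the leading digit [j] of [l], and [x -> N x - j] carries the cell onto cell
    [l %% N ^ q] of the remaining product. *)
Lemma walsh_cells A B (s : seq ('I_N * 'I_N)) :
  exists2 c : nat -> R[i],
    forall l x, (l < N ^ size s)%N ->
      l%:R / (N ^ size s)%:R <= x < l.+1%:R / (N ^ size s)%:R ->
      foldr (walsh_op B) (fun=> 1) (unzip1 s) x *
        (foldr (walsh_op A) (fun=> 1) (unzip2 s) x)^* = c l &
    \sum_(l < N ^ size s) c l =
      (N ^ size s)%:R * \prod_(d <- s) (B *m A ^t*) d.1 d.2.
Proof.
elim: s => [|[a b] s [c cE c_sum]].
  exists (fun=> 1) => [l x _ _|]; first by rewrite /= rmorph1 mulr1.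
  by rewrite big_nil sumr_const card_ord mulr1.
rewrite [size _]/= [unzip1 _]/= [unzip2 _]/=; set q := size s in cE c_sum *.
have q_gt0 : (0 < N ^ q)%N by rewrite expn_gt0 N_gt0.
have q_pos : 0 < (N ^ q)%:R :> R by rewrite ltr0n.
(* The factor [N] is the product of the two [sqrt N] of the filters; the leading digit of
   [l < N ^ q.+1] has index [q]. *)
pose c' l := N%:R * (B a (digit N_gt0 l q) * (A b (digit N_gt0 l q))^*) *
             c (l %% N ^ q)%N.
exists c' => [l x lt_l lx|]; rewrite /c'.
  have jE : digit N_gt0 l q = (l %/ N ^ q)%N :> nat.
    by rewrite /= modn_small // ltn_divLR // -expnS.
  have lE : l%:R = (digit N_gt0 l q)%:R * (N ^ q)%:R + (l %% N ^ q)%:R :> R.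
    by rewrite jE -natrM -natrD -divn_eq.
  have r_lt : (l %% N ^ q < N ^ q)%N by rewrite ltn_mod.
  have rS_le : (l %% N ^ q).+1%:R <= (N ^ q)%:R :> R by rewrite ler_nat.
  move: {jE} (digit N_gt0 l q) lE lx => j lE.
  rewrite expnSr natrM invfM !mulrA ler_pdivrMr // ltr_pdivlMr // [x * _]mulrC.
  rewrite -[l.+1]addn1 natrD lE !mulrDl mulfK ?gt_eqF // => /andP[le_x lt_x].
  have r_ge0 : 0 <= (l %% N ^ q)%:R / (N ^ q)%:R :> R by rewrite divr_ge0.
  (* Cell [l] lies inside the coarse cell [j], since [(r + 1) / N ^ q <= 1] for [r = l %% N ^ q]. *)
  have xj : j%:R / N%:R <= x < j.+1%:R / N%:R.
    rewrite ler_pdivrMr // ltr_pdivlMr // [x * _]mulrC -[j.+1]addn1 natrD.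
    rewrite (le_trans _ le_x) ?lerDl //= (lt_le_trans lt_x) // -addrA lerD2l.
    by rewrite -mulrDl -natrD addn1 ler_pdivrMr // mul1r.
  rewrite /= !(walsh_opE _ _ _ xj) -(cE (l %% N ^ q)%N (N%:R * x - j%:R)) //.
    have sqrtN_real : (sqrtC N%:R)^* = sqrtC N%:R :> R[i].
      by rewrite geC0_conj // sqrtC_ge0.
    rewrite !rmorphM /= sqrtN_real mulrACA (mulrACA (sqrtC _)) -expr2 sqrtCK.
    by rewrite !mulrA.
  by rewrite lerBrDl le_x ltrBlDl -natr1 mulrDl addrA.
(* Writing [l = j * N ^ q + r] factors the sum; the sum over [j] is the matrix product entry at
   [(a, b)]. *)
rewrite expnS (sum_ord_mul _ _ c') big_cons /= natrM -[RHS]mulrA.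
rewrite [(N ^ q)%:R * _]mulrCA -c_sum.
rewrite mxE mulr_suml mulr_sumr; apply: eq_bigr => j _.
rewrite mulrA mulr_sumr; apply: eq_bigr => r _; rewrite /c'.
have -> : digit N_gt0 (j * N ^ q + r) q = j.
  by apply: val_inj; rewrite /= divnMDl // divn_small // addn0 modn_small.
by rewrite modnMDl modn_small // !mxE -!mulrA.
Qed.

(** Agreement is asked on [0,1) only: at 1 the function [walsh_upto] can depend on the number of
    digits. *)
Lemma inner_walsh_upto A B (f g : R -> R[i]) (p n m : nat) :
  (forall x, 0 <= x < 1 -> f x = walsh_upto N_gt0 B p n x) ->
  (forall x, 0 <= x < 1 -> g x = walsh_upto N_gt0 A p m x) ->
  inner f g =
  \prod_(k < p) (B *m A ^t*) (digit N_gt0 n k) (digit N_gt0 m k).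
Proof.
move=> fE gE.
pose s := [seq (digit N_gt0 n k, digit N_gt0 m k) | k <- iota 0 p].
have s_size : size s = p by rewrite size_map size_iota.
have s1 : unzip1 s = [seq digit N_gt0 n k | k <- iota 0 p].
  by rewrite /unzip1 -map_comp.
have s2 : unzip2 s = [seq digit N_gt0 m k | k <- iota 0 p].
  by rewrite /unzip2 -map_comp.
have [c] := walsh_cells A B s; rewrite s_size s1 s2 => cE c_sum.
have Np_gt0 : (0 < N ^ p)%N by rewrite expn_gt0 N_gt0.
have Np_pos : 0 < (N ^ p)%:R :> R by rewrite ltr0n.
have fgE l x : (l < N ^ p)%N ->
    l%:R / (N ^ p)%:R <= x < l.+1%:R / (N ^ p)%:R -> f x * (g x)^* = c l.
  move=> lt_l xl; have x01 : 0 <= x < 1.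
    case/andP: xl => le_x /lt_le_trans->; last first.
      by rewrite ler_pdivrMr // mul1r ler_nat.
    by rewrite (le_trans _ le_x) // divr_ge0.
  by rewrite fE // gE // (cE l).
rewrite /inner (cintegral01_step Np_gt0 fgE) c_sum mulKf ?pnatr_eq0 -?lt0n //.
by rewrite big_map -{1}[p]subn0 big_mkord.
Qed.

(** * Tensor powers and the finite expansion in Walsh functions *)

Lemma digitS (n k : nat) : digit N_gt0 n k.+1 = digit N_gt0 (n %/ N) k.
Proof. by apply: val_inj; rewrite /= -divnMA expnS. Qed.

Lemma digit0 (i : 'I_N) (m : nat) : digit N_gt0 (m * N + i) 0 = i.
Proof. by apply: val_inj; rewrite /= divn1 modnMDl modn_small. Qed.

(** The low tensor index is digit 0, and passing to the high one shifts the digits. Exponent 1 is a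
    separate base case, as [tensor_exp] starts there from [C] itself. *)
Lemma tensor_expE C (p : nat) (i j : 'I_(N ^ p)) :
  tensor_exp C p i j = \prod_(k < p) C (digit N_gt0 i k) (digit N_gt0 j k).
Proof.
elim: p i j => [|[|p] IHp] i j.
- by rewrite big_ord0 /= (ord1 i) (ord1 j) mxE eqxx.
- rewrite big_ord1 /=; congr (C _ _); apply: val_inj => /=;
    by rewrite divn1 modn_small // -[X in (_ < X)%N]expn1.
rewrite big_ord_recl.
transitivity (C (tensor_lo i) (tensor_lo j) *
              tensor_exp C p.+1 (tensor_hi i) (tensor_hi j)).
  by rewrite [tensor_exp C p.+2]/= mxE.
rewrite IHp; congr (C _ _ * _).
- by apply: val_inj; rewrite /= divn1.
- by apply: val_inj; rewrite /= divn1.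
by apply: eq_bigr => k _; rewrite /bump /= !digitS.
Qed.

Lemma walsh_uptoS A (p n : nat) :
  walsh_upto N_gt0 A p.+1 n =
  walsh_op A (digit N_gt0 n 0) (walsh_upto N_gt0 A p (n %/ N)).
Proof.
rewrite /walsh_upto /= (iotaDl 1 0) -map_comp.
congr (walsh_op _ _ (foldr _ _ _)).
by apply: eq_map => k /=; rewrite digitS.
Qed.

Lemma walsh_filter_mulmx A B C (i : 'I_N) (x : R) :
  B = C *m A -> walsh_filter B i x = \sum_(j < N) C i j * walsh_filter A j x.
Proof.
move=> ->; rewrite /walsh_filter.
under [RHS]eq_bigr do rewrite mulrCA mulr_sumr.
rewrite -mulr_sumr exchange_big; congr (_ * _); apply: eq_bigr => k _ /=.
by rewrite mxE mulr_suml; apply: eq_bigr => j _; rewrite mulrA.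
Qed.

(** Expand the outermost filter over [i] and the remaining operators over [m]; the pair recombines
    into the index [m * N + i], whose digits are [i] followed by those of [m]. *)
Lemma walsh_upto_mulmx A B C (p n : nat) (x : R) : B = C *m A ->
  walsh_upto N_gt0 B p n x =
  \sum_(m < N ^ p) \prod_(k < p) C (digit N_gt0 n k) (digit N_gt0 m k) *
                   walsh_upto N_gt0 A p m x.
Proof.
move=> BE; elim: p n x => [|p IHp] n x.
  by rewrite big_ord1 big_ord0 mul1r.
pose F m := \prod_(k < p.+1) C (digit N_gt0 n k) (digit N_gt0 m k) *
            walsh_upto N_gt0 A p.+1 m x.
rewrite walsh_uptoS /walsh_op (walsh_filter_mulmx _ _ BE) IHp expnSr.
rewrite (sum_ord_mul _ _ F) exchange_big mulr_suml; apply: eq_bigr => i _ /=.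
rewrite mulr_sumr; apply: eq_bigr => m _.
rewrite /F walsh_uptoS big_ord_recl digit0.
rewrite divnMDl // (divn_small (ltn_ord i)) addn0 /walsh_op.
under [X in _ = _ * X * _]eq_bigr do
  rewrite /bump /= !digitS divnMDl // (divn_small (ltn_ord i)) addn0.
by rewrite mulrACA.
Qed.

End WalshDigits.

(** * Entries of the change of basis and convergence of the expansion *)

Theorem proposition3p5 (R : realType) (N : nat) (N_gt1 : (2 <= N)%N)
    (A B : 'M[R[i]]_N)
    (A_unitary : A \is unitarymx) (B_unitary : B \is unitarymx)
    (A_row0 : const_first_row A) (B_row0 : const_first_row B) :
  let N_gt0 : (0 < N)%N := ltnW N_gt1 in
  let WA : nat -> R -> R[i] := walsh N_gt0 A in
  let WB : nat -> R -> R[i] := walsh N_gt0 B in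
  let M (n m : nat) : R[i] := inner (WB n) (WA m) in
  change_of_basis WA WB M /\
  forall (n m p : nat) (p_ge1 : (1 <= p)%N)
    (n_digits : forall k, (p <= k)%N -> digit N_gt0 n k = 0%N :> nat)
    (m_digits : forall k, (p <= k)%N -> digit N_gt0 m k = 0%N :> nat),
    M n m = \prod_(k < p) (B *m A ^t*) (digit N_gt0 n k) (digit N_gt0 m k) /\
    M n m = tensor_exp (B *m A ^t*) p
              (Ordinal (digits_ltn n_digits)) (Ordinal (digits_ltn m_digits)).
Proof.
move=> N_gt0 WA WB M.
have ME n m p : (forall k, (p <= k)%N -> digit N_gt0 n k = 0%N :> nat) ->
    (forall k, (p <= k)%N -> digit N_gt0 m k = 0%N :> nat) ->
    M n m = \prod_(k < p) (B *m A ^t*) (digit N_gt0 n k) (digit N_gt0 m k).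
  move=> n0 m0; apply: inner_walsh_upto => x x01.
    by rewrite (walsh_uptoE B_row0 n0).
  by rewrite (walsh_uptoE A_row0 m0).
split=> [n|n m p p_ge1 n0 m0]; last by rewrite tensor_expE -ME.
have digit_ge k l : (k <= l)%N -> digit N_gt0 k l = 0%N :> nat.
  move=> le_kl; apply/digit_small/(leq_trans (ltn_expl k N_gt1)).
  by rewrite leq_pexp2l.
have BAA : B = (B *m A ^t*) *m A.
  exact: esym (mulmxKtV B A_unitary erefl).
(* The first rows of [A] and [B] agree, so that of [B A^*] is the first row of [A A^* = 1]. *)
have BA0 (i j : 'I_N) : i = 0%N :> nat -> j <> 0%N :> nat ->
    (B *m A ^t*) i j = 0.
  move=> i0 j0; have -> : (B *m A ^t*) i j = (A *m A ^t*) i j.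
    by rewrite !mxE; apply: eq_bigr => k _; rewrite A_row0 ?B_row0.
  have /unitarymxP-> := A_unitary; rewrite mxE; case: eqP => // ij.
  by case: j0; rewrite -ij.
have M0 m : (N ^ n <= m)%N -> M n m = 0.
  (* If all digits of [m] from index [n] on vanished, [m] would be below [N ^ n]. At the index [k]
     found here [n] has digit 0 and [m] does not, so this factor of the product kills [M n m]. *)
  move=> le_m; have [k [le_nk mk]] :
      exists k, (n <= k)%N /\ digit N_gt0 m k <> 0%N :> nat.
    apply: contrapT => nomk; have := le_m; rewrite leqNgt => /negP; apply.
    apply: (@digits_ltn _ N_gt1) => k le_nk; apply: contrapT => mk.
    by apply: nomk; exists k.
  have lt_km : (k < m)%N by rewrite ltnNge; apply/negP => /digit_ge.
  have le_nm : (n <= m)%N := leq_trans le_nk (ltnW lt_km).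
  (* [m] digits suffice for both indices, because [n <= k < m]. *)
  rewrite (ME n m m) => [|l le_l|l]; last exact: digit_ge.
    by rewrite (bigD1 (Ordinal lt_km)) //= BA0 ?mul0r //; apply: digit_ge.
  by apply: digit_ge; apply: leq_trans le_l.
have WB_sum K x : (N ^ n <= K)%N -> 0 <= x < 1 ->
    WB n x = \sum_(m < K) M n m * WA m x.
  move=> le_K x01; rewrite -(big_mkord xpredT (fun m => M n m * WA m x)).
  rewrite (@big_cat_nat _ _ _ (N ^ n)) //= [X in _ + X]big_nat_cond.
  rewrite [X in _ + X]big1 ?addr0 => [|m]; last first.
    by move=> /andP[/andP[/M0-> _] _]; rewrite mul0r.
  rewrite /WB /walsh (walsh_upto_mulmx _ _ _ _ BAA) big_mkord.
  apply: eq_bigr => m _.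
  have m0 k : (n <= k)%N -> digit N_gt0 m k = 0%N :> nat.
    move=> le_k; apply/digit_small/(leq_trans (ltn_ord m)).
    by rewrite leq_pexp2l.
  by rewrite (ME _ _ _ (digit_ge n) m0); congr (_ * _); exact: walsh_uptoE.
(* The distance is exactly 0 from [K = N ^ n] on. *)
apply: cvg_near_cst; exists (N ^ n)%N => // K /= le_K.
have dist0 : {in `[0, 1[%classic, cst 0%E =1 (fun x =>
    (ComplexField.Normc.normc (WB n x - \sum_(m < K) M n m * WA m x) ^+ 2)%:E)}.
  move=> x; rewrite inE /= in_itv /= => x01.
  by rewrite -WB_sum // subrr ComplexField.Normc.normc0 expr0n.
(* The expansion is available on [0,1) only, so the endpoint 1 is dropped as a null point; this
   leaves measurability on [0,1) to be checked. *)
rewrite /sqr_dist -integral_itv_bndo_bndc.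
  by apply: integral0_eq => x x01; rewrite -dist0 // inE.
exact: eq_measurable_fun dist0 (measurable_cst _).
Qed.
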